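(* Let $\{X_n,n\geq1\}$ be a $\varphi$-mixing sequence of random variables with common marginal distribution function $F$, whose mixing coefficients satisfy $\sum_{n=1}^\infty\varphi^{1/2}(n)<\infty$. Fix $p\in(0,1)$ and let $\xi_p=\inf\{x:F(x)\geq p\}$. Assume that $F$ possesses a positive continuous density $f$ in a neighborhood $\mathscr{N}_p$ of $\xi_p$ such that $0<d=\sup\{f(x):x\in\mathscr{N}_p\}<\infty$. Let $C_3=4\big[1+4\sum_{n=1}^\infty\varphi^{1/2}(n)\big]$. For any $\theta>0$ put $$\tau_n=\frac{\sqrt{16C_3+\theta}\,(\log n)^{3/2}}{n^{1/2}(\log\log n)^{1/2}},\qquad \mathscr{E}_n=[\xi_p-\tau_n,\xi_p+\tau_n].$$ Then with probability 1, $$\sup_{x\in\mathscr{E}_n}\big|(F_n(x)-F(x))-(F_n(\xi_p)-p)\big|\leq(1+d)\left(\frac{(16C_3+\theta)\log n}{n}\right)^{1/2}$$ for all $n$ sufficiently large.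
   Context: All random variables are defined on a probability space $(\Omega,\mathcal{F},P)$. $F_n(x)=\frac1n\sum_{i=1}^n I(X_i\leq x)$ is the empirical distribution function of $X_1,\dots,X_n$. For $n\leq m$ let $\mathcal{F}_n^m=\sigma(X_i,n\leq i\leq m)$. For sub-$\sigma$-algebras $\mathcal{B},\mathcal{R}$ let $\varphi(\mathcal{B},\mathcal{R})=\sup_{A\in\mathcal{B},B\in\mathcal{R},P(A)>0}|P(B\mid A)-P(B)|$, and the mixing coefficients are $\varphi(n)=\sup_{k\geq1}\varphi(\mathcal{F}_1^k,\mathcal{F}_{k+n}^\infty)$. The sequence is called $\varphi$-mixing if $\varphi(n)\downarrow0$ as $n\to\infty$. *)

(* Defs.v *)
From HB Require Import structures.
From mathcomp Require Import all_boot all_order all_algebra.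
From mathcomp Require Import all_classical all_reals all_analysis.
Set Implicit Arguments. Unset Strict Implicit. Unset Printing Implicit Defensive.
Import Order.TTheory GRing.Theory Num.Theory.
Import numFieldNormedType.Exports.
Local Open Scope classical_set_scope.
Local Open Scope ring_scope.

Section Defs.
Context {d : measure_display} {T : measurableType d} {R : realType}.
Variable (P : probability T R) (X : nat -> T -> R).

Definition gen_sigma (S : set nat) : set (set T) :=
  <<s [set A | exists2 i, S i & exists2 B : set R, measurable B & A = X i @^-1` B] >>.

Definition Fnm (n m : nat) : set (set T) := gen_sigma [set i | (n <= i <= m)%N].
Definition Fninf (n : nat) : set (set T) := gen_sigma [set i | (n <= i)%N].

Definition condP (B A : set T) : R := fine (P (A `&` B)) / fine (P A).

Definition phi_sig (Bs Rs : set (set T)) : \bar R :=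
  ereal_sup [set y | exists A C, [/\ Bs A, Rs C, (0 < P A)%E &
                     y = (`| condP C A - fine (P C) |)%:E]].

(* phi(n) = sup_{k >= 1} phi(F_1^k, F_{k+n}^oo)  (values lie in [0,1]) *)
Definition phi_mix (n : nat) : R :=
  fine (ereal_sup [set phi_sig (Fnm 1 k) (Fninf (k + n)) | k in [set k | (1 <= k)%N]]).

Definition empF (n : nat) (w : T) (x : R) : R :=
  n%:R^-1 * \sum_(1 <= i < n.+1) (((X i w <= x)%R)%:R : R).
End Defs.

(* Main.v *)
(* Only the order sqrt(log n / n) of the bound matters, not its constants: the
   proof gives almost surely a bound O(n^{-1/2}).  For x within tau_n of xi,
   F_n(x) - F_n(xi) is 1/n times the number of X_i in an interval of probability
   q = O(tau_n), and phi-mixing, with sum phi(k) <= sum phi(k)^{1/2}, bounds the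
   variance of that count by n q (1 + 2 sum phi(k)^{1/2}).  So Chebyshev's
   inequality at level n^{1/2} costs only O(q).  Along n = a^8, with a grid of
   a + 1 points of spacing a^{-4} on each side of xi, these costs sum to
   O(a^{-2}) and Borel-Cantelli applies.  Counts are monotone both in n and in
   the interval, and consecutive times differ by O(a^7) while q = O(a^{-3}), so
   interpolating in time and space loses only O(a^4) = O(n^{1/2}) in the count. *)
Require Import Defs.
From HB Require Import structures.
From mathcomp Require Import all_boot all_order all_algebra.
From mathcomp Require Import all_classical all_reals all_analysis.
From mathcomp Require Import measurable_realfun ring lra.
Import Order.TTheory GRing.Theory Num.Theory.
Import numFieldNormedType.Exports.
Local Open Scope classical_set_scope.
Local Open Scope ring_scope.

(** * Second moments and Chebyshev's inequality for counts of events *)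

Lemma sqr_deviation_events (d : measure_display) (T : measurableType d)
    (R : realType) (P : probability T R) (A : nat -> set T) (q : R) (m : nat) :
  (forall i, measurable (A i)) -> (forall i, P (A i) = q%:E) -> 0 <= q ->
  (\int[P]_w ((\sum_(i < m) \1_(A i) w - m%:R * q) ^+ 2)%:E =
   (\sum_(i < m) \sum_(j < m) (fine (P (A i `&` A j)) - q ^+ 2))%:E)%E.
Proof.
move=> mA PA q0.
pose s w : R := \sum_(i < m) \1_(A i) w.
have ms : measurable_fun setT s.
  by apply: measurable_sum => i; exact: measurable_indic.
have s0 w : 0 <= s w by apply: sumr_ge0 => i _.
have Is : (\int[P]_w (s w)%:E = (m%:R * q)%:E)%E.
  under eq_integral do rewrite /s -sumEFin.
  rewrite ge0_integral_sum//; last first.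
    by move=> i; apply/measurable_EFinP; exact: measurable_indic.
  rewrite (eq_bigr (fun=> q%:E)); last first.
    by move=> i _; rewrite integral_indic// setIT; exact: PA.
  by rewrite sumEFin sumr_const card_ord mulr_natl.
have Is2 : (\int[P]_w (s w ^+ 2)%:E =
    (\sum_(i < m) \sum_(j < m) fine (P (A i `&` A j)))%:E)%E.
  have E w : ((s w ^+ 2)%:E = \sum_(i < m) \sum_(j < m) (\1_(A i `&` A j) w)%:E)%E.
    rewrite expr2 /s big_distrl/= -sumEFin; apply: eq_bigr => i _.
    rewrite big_distrr/= -sumEFin; apply: eq_bigr => j _.
    by rewrite indicI.
  under eq_integral do rewrite E.
  rewrite ge0_integral_sum//; last 2 first.
    move=> i; apply: emeasurable_sum => j; apply/measurable_EFinP.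
    by apply: measurable_indic; exact: measurableI.
    by move=> i w _; apply: sume_ge0 => j _; rewrite lee_fin.
  rewrite -sumEFin; apply: eq_bigr => i _.
  rewrite ge0_integral_sum//; last first.
    move=> j; apply/measurable_EFinP.
    by apply: measurable_indic; exact: measurableI.
  rewrite -sumEFin; apply: eq_bigr => j _.
  rewrite integral_indic ?setIT//; last exact: measurableI.
  by rewrite fineK// fin_num_measure//; exact: measurableI.
have mq0 : 0 <= m%:R * q by rewrite mulr_ge0.
(* All terms of (s - mq)^2 + 2mq s = s^2 + (mq)^2 are nonnegative, so integrating this
   identity needs no integrability. *)
have : (\int[P]_w (((s w - m%:R * q) ^+ 2)%:E + (2 * (m%:R * q))%:E * (s w)%:E) =
        \int[P]_w ((s w ^+ 2)%:E + cst ((m%:R * q) ^+ 2)%:E w))%E.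
  by apply: eq_integral => w _; rewrite /= -EFinM -!EFinD; congr (_%:E); ring.
have ms2 : measurable_fun setT (fun w => ((s w - m%:R * q) ^+ 2)%:E).
  by apply/measurable_EFinP/measurable_funX/measurable_funB.
have msq : measurable_fun setT (fun w => (s w ^+ 2)%:E).
  by apply/measurable_EFinP/measurable_funX.
rewrite ge0_integralD//; last 3 first.
- by move=> w _; rewrite lee_fin sqr_ge0.
- by move=> w _; rewrite -EFinM lee_fin !mulr_ge0.
- by apply: emeasurable_funM => //; exact/measurable_EFinP.
rewrite ge0_integralZl_EFin//; last 3 first.
- by move=> w _; rewrite lee_fin.
- exact/measurable_EFinP.
- by rewrite mulr_ge0.
rewrite (@ge0_integralD _ _ _ P _ measurableT (fun w => (s w ^+ 2)%:E))//;
  last 2 first.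
- by move=> w _; rewrite lee_fin sqr_ge0.
- by move=> w _; rewrite lee_fin sqr_ge0.
have -> : (\int[P]_w cst ((m%:R * q) ^+ 2)%:E w = ((m%:R * q) ^+ 2)%:E)%E.
  rewrite integral_cst// -[RHS]mule1; congr (_ * _)%E; exact: probability_setT.
rewrite Is Is2 -EFinM -EFinD.
set I := (\int[P]_w _)%E; move=> H.
(* The other terms of [H] are real, so an infinite [I] is impossible and [H] can be solved for [I]
   in the reals. *)
have If : I \is a fin_num.
  move: H; case: I => //.
move: H; rewrite -(fineK If) -EFinD => -[H]; congr (_%:E).
rewrite (eq_bigr (fun i : 'I_m => \sum_(j < m) fine (P (A i `&` A j)) - m%:R * q ^+ 2)).
  rewrite sumrB sumr_const card_ord -[X in _ - X]mulr_natl.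
  move: H; set a := fine I; set b := \sum_(i < m) _; set c := m%:R; lra.
by move=> i _; rewrite sumrB sumr_const card_ord mulr_natl.
Qed.

(** Induction on [m]: passing to [m.+1] adds one diagonal entry, at most [q], and a row and a column
    whose entries have lags 1 to [m], so that each of the two sums is at most [S * q]. *)
Lemma sum_cov_le (R : realType) (c : nat -> nat -> R) (phi : nat -> R) (q S : R)
    (m : nat) :
  0 <= q -> (forall i j, c i j = c j i) -> (forall i, c i i <= q) ->
  (forall i k, c i (i + k.+1)%N <= phi k * q) ->
  (forall n, \sum_(k < n) phi k <= S) ->
  \sum_(i < m) \sum_(j < m) c i j <= m%:R * q * (1 + 2 * S).
Proof.
move=> q0 csym cd cphi phiS; elim: m => [|m IH].
  by rewrite big_ord0 !mul0r.
rewrite big_ord_recr/= [X in _ + X]big_ord_recr/=.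
rewrite (eq_bigr (fun i : 'I_m => \sum_(j < m) c i j + c i m)); last first.
  by move=> i _; rewrite big_ord_recr.
rewrite big_split/=.
have E : \sum_(i < m) c i m <= S * q.
  (* Reversing the indices turns the [i]-th term into the entry at lag [i.+1], which [phi i]
     controls. *)
  rewrite (reindex_inj rev_ord_inj)/=.
  apply: (@le_trans _ _ (\sum_(i < m) phi i * q)).
    apply: ler_sum => i _.
    have := cphi (m - i.+1)%N i; rewrite subnK//.
  by rewrite -mulr_suml ler_wpM2r.
have E' : \sum_(i < m) c m i <= S * q.
  by rewrite (eq_bigr (fun i : 'I_m => c i m)) => // i _; exact: csym.
have := cd m; have -> : (m.+1%:R : R) = m%:R + 1 by rewrite -natr1.
move: IH E E'; set u := \sum_(i < m) _; set v := \sum_(i < m) _.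
set x := \sum_(i < m) _; set y := (c m m); set k := m%:R; lra.
Qed.

(** Chebyshev's inequality. The covariance at lag [k.+1] is at most [phi k * q] by hypothesis, and
    the diagonal terms [q - q ^ 2] are at most [q], so [sum_cov_le] bounds the variance. *)
Lemma deviation_events (d : measure_display) (T : measurableType d)
    (R : realType) (P : probability T R) (A : nat -> set T) (phi : nat -> R)
    (q S t : R) (m : nat) :
  (forall i, measurable (A i)) -> (forall i, P (A i) = q%:E) ->
  (forall i k, fine (P (A i `&` A (i + k.+1)%N)) <= q * q + phi k * q) ->
  (forall n, \sum_(k < n) phi k <= S) -> 0 < t ->
  (P [set w | (t <= `|\sum_(i < m) \1_(A i) w - m%:R * q|)%R] <=
   (m%:R * q * (1 + 2 * S) / t ^+ 2)%:E)%E.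
Proof.
move=> mA PA cphi phiS t0.
have q0 : 0 <= q by rewrite -lee_fin -(PA 0).
pose h w : R := (\sum_(i < m) \1_(A i) w - m%:R * q) ^+ 2.
have mh : measurable_fun setT (EFin \o h).
  apply/measurable_EFinP/measurable_funX/measurable_funB => //.
  by apply: measurable_sum => i; exact: measurable_indic.
have t20 : 0 < t ^+ 2 by rewrite exprn_gt0.
have Eh : [set w | t <= `|\sum_(i < m) \1_(A i) w - m%:R * q|] =
    [set w | ((t ^+ 2)%:E <= `|(EFin \o h) w|)%E].
  apply: eq_set => w; rewrite [in RHS]/= lee_fin /h normrX.
  by rewrite ler_pXn2r// nnegrE// ltW.
(* Markov's inequality for the squared deviation at level [t ^ 2]. *)
have := le_integral_abse P measurableT mh t20.
under eq_integral do rewrite gee0_abs ?lee_fin ?sqr_ge0//.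
rewrite sqr_deviation_events// setTI -Eh => H.
rewrite EFinM lee_pdivlMr// muleC; apply: (le_trans H); rewrite lee_fin.
apply: (@sum_cov_le _ (fun i j => fine (P (A i `&` A j)) - q ^+ 2) phi) => //.
- by move=> i j; rewrite setIC.
- by move=> i; rewrite setIid PA/= gerBl sqr_ge0.
- by move=> i k; rewrite lerBlDl expr2.
Qed.

(** * Mixing coefficients and covariances *)

Section PhiMixing.
Context {d : measure_display} {T : measurableType d} {R : realType}.
Variables (P : probability T R) (X : nat -> T -> R).
Hypothesis mX : forall i, measurable_fun setT (X i).

Lemma gen_sigma_measurable (S : set nat) : gen_sigma X S `<=` measurable.
Proof.
apply: smallest_sub; first exact: sigma_algebra_measurable.
move=> _ [i _ [B mB ->]]; rewrite -[X in measurable X]setTI.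
exact: mX.
Qed.

Lemma gen_sigma_preimage (S : set nat) i (B : set R) :
  S i -> measurable B -> gen_sigma X S (X i @^-1` B).
Proof. by move=> Si mB; apply: sub_sigma_algebra; exists i => //; exists B. Qed.

Lemma fine_probability_ge0 (A : set T) : 0 <= fine (P A).
Proof. exact: fine_ge0. Qed.

Lemma fine_probability_le (A B : set T) : measurable A -> measurable B ->
  A `<=` B -> fine (P A) <= fine (P B).
Proof.
move=> mA mB AB; apply: fine_le; rewrite ?fin_num_measure//.
by apply: le_measure => //; rewrite inE.
Qed.

Lemma fine_probability_le1 (A : set T) : measurable A -> fine (P A) <= 1.
Proof.
move=> mA; rewrite -lee_fin fineK ?fin_num_measure//.
exact: probability_le1.
Qed.

Lemma condP_dist_le1 (A C : set T) : measurable A -> measurable C ->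
  `|condP P C A - fine (P C)| <= 1.
Proof.
move=> mA mC.
have c0 : 0 <= condP P C A by rewrite divr_ge0// fine_probability_ge0.
have c1 : condP P C A <= 1.
  (* Division by zero gives 0, so a null [A] satisfies the bound as well. *)
  rewrite /condP; have [->|A0] := eqVneq (fine (P A)) 0.
    by rewrite invr0 mulr0.
  rewrite ler_pdivrMr ?mul1r; last by rewrite lt_neqAle eq_sym A0 fine_probability_ge0.
  by apply: fine_probability_le => //; exact: measurableI.
have := fine_probability_le1 C mC; have := fine_probability_ge0 C.
by rewrite ler_norml; move: c0 c1; lra.
Qed.

(** The pair of the whole space and the empty set contributes the value 0, so the supremum is not
    over an empty family. These bounds make the coefficients finite. *)
Lemma phi_sig_gen_sigma_bounds (S1 S2 : set nat) :
  (0 <= phi_sig P (gen_sigma X S1) (gen_sigma X S2) <= 1)%E.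
Proof.
apply/andP; split.
  apply: ereal_sup_ubound; exists setT, set0; split.
  - have [s0 sC _] : sigma_algebra setT (gen_sigma X S1).
      exact: smallest_sigma_algebra.
    by rewrite -(setD0 setT); exact: sC.
  - by have [] : sigma_algebra setT (gen_sigma X S2)
      by exact: smallest_sigma_algebra.
  - by rewrite probability_setT.
  - by rewrite /condP setI0 measure0/= mul0r subrr normr0.
apply: ge_ereal_sup => _ [A [C [SA SC _ ->]]].
rewrite lee_fin; apply: condP_dist_le1.
- exact: gen_sigma_measurable SA.
- exact: gen_sigma_measurable SC.
Qed.

(** [fine] sends infinite values to 0; since the supremum lies in [0,1], it loses nothing here and
    [phi_mix] may be compared with each term of the supremum. *)
Lemma phi_mixE n : (phi_mix P X n)%:E =
  ereal_sup [set phi_sig P (Fnm X 1 k) (Fninf X (k + n)) | k in [set k | (1 <= k)%N]].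
Proof.
rewrite /phi_mix fineK// fin_numElt; apply/andP; split.
  apply: (@lt_le_trans _ _ 0%E) => //.
  apply: (@le_trans _ _ (phi_sig P (Fnm X 1 1) (Fninf X (1 + n)))).
    by have /andP[] := phi_sig_gen_sigma_bounds [set i | (1 <= i <= 1)%N] [set i | (1 + n <= i)%N].
  by apply: ereal_sup_ubound; exists 1%N.
apply: (@le_lt_trans _ _ 1%E); last exact: ltry.
apply: ge_ereal_sup => _ [k _ <-].
by have /andP[] := phi_sig_gen_sigma_bounds [set i | (1 <= i <= k)%N] [set i | (k + n <= i)%N].
Qed.

Lemma phi_mix_ge0 n : 0 <= phi_mix P X n.
Proof.
rewrite -lee_fin phi_mixE; apply: le_ereal_sup_tmp.
exists (phi_sig P (Fnm X 1 1) (Fninf X (1 + n))); first by exists 1%N.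
by have /andP[] := phi_sig_gen_sigma_bounds [set i | (1 <= i <= 1)%N] [set i | (1 + n <= i)%N].
Qed.

Lemma phi_mix_le1 n : phi_mix P X n <= 1.
Proof.
rewrite -lee_fin phi_mixE; apply: ge_ereal_sup => _ [k _ <-].
by have /andP[] := phi_sig_gen_sigma_bounds [set i | (1 <= i <= k)%N] [set i | (k + n <= i)%N].
Qed.

(** A number of [0,1] is at most its root; this turns summability of the roots into a bound on the
    sum of the coefficients themselves. *)
Lemma phi_mix_le_sqrt n : phi_mix P X n <= Num.sqrt (phi_mix P X n).
Proof.
rewrite -{1}(sqr_sqrtr (phi_mix_ge0 n)) expr2 ler_piMr ?sqrtr_ge0//.
by rewrite -sqrtr1 ler_wsqrtr// phi_mix_le1.
Qed.

(** The defining bound on the conditional probability is multiplied by [P A]. Null events are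
    treated apart, as the supremum omits them. An upper bound suffices, since only variances are to
    be bounded. *)
Lemma phi_mix_cov i n (A C : set T) : (1 <= i)%N ->
  Fnm X 1 i A -> Fninf X (i + n) C ->
  fine (P (A `&` C)) <= fine (P A) * fine (P C) + phi_mix P X n * fine (P A).
Proof.
move=> i1 SA SC; have mA := gen_sigma_measurable _ _ SA.
have mC := gen_sigma_measurable _ _ SC.
have [A0|A0] := eqVneq (fine (P A)) 0.
  rewrite A0 mul0r mulr0 addr0 -A0; apply: fine_probability_le => //.
  exact: measurableI.
have A_gt0 : 0 < fine (P A) by rewrite lt_neqAle eq_sym A0 fine_probability_ge0.
have : `|condP P C A - fine (P C)| <= phi_mix P X n.
  rewrite -lee_fin phi_mixE.
  apply: (@le_trans _ _ (phi_sig P (Fnm X 1 i) (Fninf X (i + n)))).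
    apply: ereal_sup_ubound; exists A, C; split => //.
    by rewrite -(fineK (fin_num_measure P A mA)) lte_fin.
  by apply: ereal_sup_ubound; exists i.
rewrite ler_norml => /andP[_]; rewrite lerBlDl /condP ler_pdivrMr//.
by move/le_trans; apply; rewrite mulrDl (mulrC (fine (P C))).
Qed.

End PhiMixing.

(** * Counts of observations in intervals and their deviations *)

(** The interval is open on the left so that the count is exactly [n] times an increment of
    [empF]. *)
Definition cnt {T : Type} {R : realType} (X : nat -> T -> R) (n : nat) (x y : R)
  (w : T) : R := \sum_(1 <= i < n.+1) ((x < X i w <= y)%R)%:R.

Section Counts.
Context {T : Type} {R : realType}.
Variable (X : nat -> T -> R).

Lemma cnt_homo n n' x x' y y' w : (n <= n')%N -> x' <= x -> y <= y' ->
  cnt X n x y w <= cnt X n' x' y' w.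
Proof.
move=> nn' xx' yy'; rewrite /cnt [leRHS](big_cat_nat (n := n.+1))//=.
apply: ler_wpDr; first by apply: sumr_ge0 => i _; rewrite ler0n.
apply: ler_sum => i _; rewrite ler_nat.
case: (boolP (_ < _ <= _)) => // /andP[h1 h2].
by rewrite (le_lt_trans xx' h1) (le_trans h2 yy').
Qed.

Lemma cntE m x y w :
  cnt X m x y w = \sum_(i < m) \1_(X i.+1 @^-1` `]x, y]) w.
Proof.
rewrite /cnt big_add1 big_mkord; apply: eq_bigr => i _.
by rewrite indicE; congr (_ %:R); congr nat_of_bool; apply/idP/idP;
  rewrite inE/= in_itv.
Qed.
End Counts.

Lemma empFB {d : measure_display} {T : measurableType d} {R : realType}
    (X : nat -> T -> R) n w (x y : R) : x <= y ->
  empF X n w y - empF X n w x = n%:R^-1 * cnt X n x y w.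
Proof.
move=> xy; rewrite /empF -mulrBr -sumrB; congr (_ * _); apply: eq_bigr => i _.
case: (leP (X i w) x) => [h|h]; last by rewrite subr0.
by rewrite (le_trans h xy) subrr.
Qed.

Section CountDeviation.
Context {d : measure_display} {T : measurableType d} {R : realType}.
Variables (P : probability T R) (X : nat -> T -> R) (F : R -> R).
Hypothesis mX : forall i, measurable_fun setT (X i).
Hypothesis XF : forall i, (1 <= i)%N -> forall x, P [set w | X i w <= x] = (F x)%:E.
Hypothesis cvg_sqrt_phi : cvgn (series (fun k => Num.sqrt (phi_mix P X k.+1))).
Let S := limn (series (fun k => Num.sqrt (phi_mix P X k.+1))).

Lemma sum_sqrt_phi_mix_ge0 : 0 <= S.
Proof.
apply: limr_ge => //; apply: nearW => n; rewrite /series/=.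
by apply: sumr_ge0 => k _; exact: sqrtr_ge0.
Qed.

Lemma sum_phi_mix_le n : \sum_(k < n) phi_mix P X k.+1 <= S.
Proof.
apply: (@le_trans _ _ (series (fun k => Num.sqrt (phi_mix P X k.+1)) n)).
  rewrite /series/= big_mkord; apply: ler_sum => k _.
  exact: phi_mix_le_sqrt.
apply: nondecreasing_cvgn_le => //.
by apply/nondecreasing_seqP => m; rewrite /series/= big_nat_recr//= lerDl sqrtr_ge0.
Qed.

Lemma measurable_le_rv i x : measurable [set w | X i w <= x].
Proof.
have -> : [set w | X i w <= x] = setT `&` X i @^-1` `]-oo, x].
  by apply/seteqP; split => w /=; rewrite in_itv/= => // -[].
exact: mX.
Qed.

Lemma preimage_itv i x y : X i @^-1` `]x, y] = [set w | X i w <= y] `\` [set w | X i w <= x].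
Proof.
apply/seteqP; split => w /=; rewrite in_itv/=.
  by move=> /andP[h1 h2]; split => //; apply/negP; rewrite -ltNge.
by move=> [-> /negP]; rewrite -ltNge => ->.
Qed.

Lemma cdf_homo x y : x <= y -> F x <= F y.
Proof.
move=> xy; rewrite -lee_fin -(XF 1%N)// -(XF 1%N)//.
apply: le_measure; rewrite ?inE; try exact: measurable_le_rv.
by move=> w /=/le_trans; exact.
Qed.

Lemma probability_itv i x y : (1 <= i)%N -> x <= y ->
  P (X i @^-1` `]x, y]) = (F y - F x)%:E.
Proof.
move=> i1 xy; rewrite preimage_itv measureD; try exact: measurable_le_rv; last first.
  exact: (eq_ind_r (fun z => z < +oo)%E (ltry (F y)) (XF i i1 y)).
rewrite setIidr; last by move=> w /=/le_trans; exact.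
by rewrite EFinB; congr (_ - _)%E; exact: XF.
Qed.

Lemma measurable_cnt m x y : measurable_fun setT (cnt X m x y).
Proof.
have -> : cnt X m x y = fun w => \sum_(i < m) \1_(X i.+1 @^-1` `]x, y]) w.
  by apply/funext => w; rewrite cntE.
apply: measurable_sum => i; apply: measurable_indic.
by rewrite preimage_itv; apply: measurableD; exact: measurable_le_rv.
Qed.

Definition cnt_dev (t : R) m x y : set T :=
  [set w | t <= `|cnt X m x y w - m%:R * (F y - F x)|].

Lemma measurable_cnt_dev t m x y : measurable (cnt_dev t m x y).
Proof.
rewrite -[X in measurable X]setTI.
apply: measurable_fun_le => //.
apply: measurableT_comp => //; apply: measurable_funB => //.
exact: measurable_cnt.
Qed.

(** [deviation_events] for the events that an observation falls in the interval, with the mixing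
    inequality as covariance bound. *)
Lemma probability_cnt_dev t m x y : x <= y -> 0 < t ->
  (P (cnt_dev t m x y) <= (m%:R * (F y - F x) * (1 + 2 * S) / t ^+ 2)%:E)%E.
Proof.
move=> xy t0; rewrite /cnt_dev.
under eq_set do rewrite cntE.
apply: (@deviation_events _ _ _ P (fun i => X i.+1 @^-1` `]x, y]) (fun k => phi_mix P X k.+1)) => //.
- by move=> i; rewrite preimage_itv; apply: measurableD; exact: measurable_le_rv.
- by move=> i; rewrite probability_itv.
(* Event [i] concerns observation [i.+1], so the past index is at least 1 and the gap [k.+1] matches
   the shifted coefficient. *)
- move=> i k; have := phi_mix_cov P X mX i.+1 k.+1.
  move=> /(_ (X i.+1 @^-1` `]x, y]) (X (i + k.+1).+1 @^-1` `]x, y])).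
  rewrite !probability_itv//=; apply => //.
  + by apply: gen_sigma_preimage => //=; rewrite leqnn.
  + by apply: gen_sigma_preimage => //=; rewrite addSn.
- exact: sum_phi_mix_le.
Qed.
End CountDeviation.

(** * Interpolation between grid points and between times *)

Lemma grid_cell (R : realType) (s u : R) M : 0 <= u <= M.+1%:R * s ->
  exists2 k, (k <= M)%N & k%:R * s <= u <= k.+1%:R * s.
Proof.
elim: M => [|M IH] /andP[u0 uM].
  by exists 0%N => //; rewrite mul0r u0.
case: (leP u (M.+1%:R * s)) => h.
  by have [|k kM hk] := IH; [rewrite u0|exists k => //; exact: leqW].
by exists M.+1 => //; rewrite (ltW h).
Qed.

(* Monotonicity of counts in time and space interpolates between the grid
   points and between the times n0 and n1. *)
Lemma grid_deviation (R : realType) (c : nat -> R -> R) (q : R -> R) (L s t : R)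
    (n0 n n1 M : nat) (u : R) :
  (forall m m' v v', (m <= m')%N -> 0 <= v -> v <= v' -> c m v <= c m' v') ->
  q 0 = 0 ->
  (forall v v', 0 <= v -> v <= v' -> v' <= M.+1%:R * s ->
    0 <= q v' - q v <= L * (v' - v)) ->
  (forall k, (k <= M.+1)%N -> `|c n0 (k%:R * s) - n0%:R * q (k%:R * s)| <= t) ->
  (forall k, (k <= M.+1)%N -> `|c n1 (k%:R * s) - n1%:R * q (k%:R * s)| <= t) ->
  (n0 <= n <= n1)%N -> 0 <= s -> 0 <= L -> 0 <= u <= M.+1%:R * s ->
  `|c n u - n%:R * q u| <=
    t + (n1%:R - n0%:R) * (L * (M.+1%:R * s)) + n%:R * (L * s).
Proof.
move=> cM q0 qL d0 d1 /andP[n0n nn1] s0 L0 uM.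
have [k kM /andP[ku uk]] := grid_cell R s u M uM.
have {uM}/andP[u0 uM] := uM.
set a := k%:R * s in ku; set b := k.+1%:R * s in uk.
have a0 : 0 <= a by rewrite mulr_ge0.
have ba : b - a = s by rewrite /a /b -natr1; ring.
have bM : b <= M.+1%:R * s by rewrite ler_wpM2r// ler_nat.
have b0 : 0 <= b by lra.
have ab : a <= b by lra.
have aM := le_trans ab bM.
have /andP[qa0 _] := qL 0 a (lexx 0) a0 aM.
have /andP[_ qb1] := qL 0 b (lexx 0) b0 bM.
have /andP[qau _] := qL a u a0 ku uM.
have /andP[qub _] := qL u b u0 uk bM.
have /andP[qab0 qab] := qL a b a0 ab bM.
rewrite ba in qab; rewrite !q0 !subr0 in qa0 qb1.
have := d0 k (leqW kM); rewrite ler_norml => /andP[h0 _].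
have := d1 k.+1 kM; rewrite ler_norml => /andP[_ h1].
have cl := cM n0 n a u n0n a0 ku.
have cu := cM n n1 u b nn1 u0 uk.
have qb : q b <= L * (M.+1%:R * s) by apply: (le_trans qb1); rewrite ler_wpM2l.
have N0 : (n0%:R : R) <= n%:R by rewrite ler_nat.
have N1 : (n%:R : R) <= n1%:R by rewrite ler_nat.
have Z0 : 0 <= (n0%:R : R) by [].
rewrite -/a -/b in h0 h1.
set Q := L * (M.+1%:R * s) in qb *.
set x0 : R := n0%:R in h0 N0 Z0 *; set x1 : R := n1%:R in h1 N1 *.
set x : R := n%:R in N0 N1 *.
(* Above: [c n u <= c n1 b <= x1 * q b + t], and [x1 * q b - x * q u] splits into [(x1 - x) * q b]
   and [x * (q b - q u)]. Below: [c n0 a <= c n u], and [x * q u - x0 * q a] splits into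
   [(x - x0) * q a] and [x * (q u - q a)]. The first parts are errors in time, the second in
   space. *)
have E1 : (x1 - x0) * q b <= (x1 - x0) * Q by rewrite ler_wpM2l//; lra.
have E2 : x * (q b - q a) <= x * (L * s) by rewrite ler_wpM2l//; lra.
have E3 : x * q a <= x * q u by rewrite ler_wpM2l//; lra.
have E4 : x * q u <= x * q b by rewrite ler_wpM2l//; lra.
have E5 : (x1 - x) * q b <= (x1 - x0) * q b by rewrite ler_wpM2r//; lra.
have E6 : (x - x0) * q a <= (x1 - x0) * q b by rewrite ler_pM//; lra.
rewrite ler_norml; apply/andP; split.
- lra.
- lra.
Qed.

(** * The distribution function near the quantile *)

(** The limits 0 and 1 of [F] make the infimum genuine. By continuity, [F xi > p] would persist to
    the left of [xi], below the infimum, and [F xi < p] would persist to the right, where points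
    with [p <= F y] come arbitrarily close. *)
Lemma cdf_quantile (d : measure_display) (T : measurableType d) (R : realType)
    (P : probability T R) (Y : T -> R) (F : R -> R) (p : R) :
  measurable_fun setT Y -> (forall x, P [set w | Y w <= x] = (F x)%:E) ->
  0 < p < 1 -> let xi := inf [set x | p <= F x] in
  {for xi, continuous F} -> F xi = p.
Proof.
move=> mY YF /andP[p0 p1] xi Fc.
(* Packing [Y] as a random variable gives access to the limits of its [cdf]. *)
pose Z : {RV P >-> R} := HB.pack Y (isMeasurableFun.Build _ _ _ _ Y mY).
have cdfF : cdf Z = EFin \o F.
  apply/funext => r; rewrite /cdf /distribution/= /pushforward/= -YF.
  by congr (P _); apply/seteqP; split => w /=; rewrite in_itv.
have Fy : F x @[x --> +oo] --> (1 : R).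
  by have := cvg_cdfy1 Z; rewrite cdfF => /fine_cvg.
have FNy : F x @[x --> -oo] --> (0 : R).
  by have := cvg_cdfNy0 Z; rewrite cdfF => /fine_cvg.
have Fhomo x y : x <= y -> F x <= F y.
  move=> xy; rewrite -lee_fin -!YF.
  have mle z : measurable [set w | Y w <= z].
    exact: (measurable_le_rv (fun=> Y) (fun=> mY) 0).
  apply: le_measure; rewrite ?inE//.
  by move=> w /=/le_trans; exact.
have [x0 x0p] : exists x, p <= F x.
  have : \forall x \near +oo, p < F x by apply: cvgr_gt p1.
  by move=> [M [_ HM]]; exists (M + 1); apply/ltW/HM; rewrite ltrDl.
have [x1 x1p] : exists x, F x < p.
  have : \forall x \near -oo, F x < p by apply: cvgr_lt p0.
  by move=> [M [_ HM]]; exists (M - 1); apply/HM; rewrite ltrBlDr ltrDl.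
have hS : has_inf [set x | p <= F x].
  split; first by exists x0.
  exists x1 => x /= px; rewrite leNgt; apply/negP => xx1.
  by have := Fhomo _ _ (ltW xx1); lra.
apply/eqP; rewrite eq_le !leNgt; apply/andP; split; apply/negP => h.
- have /nbhs_ballP[e /= e0 He] : \forall x \near xi, p < F x by exact: (cvgr_gt _ Fc).
  have : p < F (xi - e / 2).
    by apply: He; rewrite /ball/= opprB addrC subrK gtr0_norm ?divr_gt0//; lra.
  move=> /ltW/(ge_inf hS.2); rewrite -/xi; lra.
- have /nbhs_ballP[e /= e0 He] : \forall x \near xi, F x < p by exact: (cvgr_lt _ Fc).
  have [y /= py yxi] := inf_adherent e0 hS.
  rewrite -/xi in yxi.
  have xiy : xi <= y by exact: ge_inf hS.2 _ py.
  have : F y < p by apply: He; rewrite /ball/= ltr_norml; lra.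
  by rewrite ltNge py.
Qed.

(** Mean value theorem on a segment inside a ball contained in [N], where the derivative is at most
    the supremum of [f]. *)
Lemma density_lipschitz (R : realType) (F f : R -> R) (N : set R) (xi : R) :
  open N -> N xi -> (forall x, N x -> is_derive x 1 F (f x)) ->
  has_ubound (f @` N) ->
  exists2 e, 0 < e & forall x y, xi - e < x -> x <= y -> y < xi + e ->
    F y - F x <= sup (f @` N) * (y - x).
Proof.
move=> oN Nxi dF ubf.
have /nbhs_ballP[e /= e0 He] : nbhs xi N by exact: open_nbhs_nbhs.
exists e => // x y ex xy ye.
have NI z : x <= z <= y -> N z.
  by move=> /andP[xz zy]; apply: He; rewrite /ball/= ltr_norml; lra.
have [||c] := @MVT_segment R F f x y xy.
- by move=> z; rewrite in_itv/= => /andP[xz zy]; apply/dF/NI; rewrite !ltW.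
- apply: derivable_within_continuous => z; rewrite in_itv/= => zI.
  by have [] := dF z (NI z zI).
rewrite in_itv/= => cI ->; apply: ler_wpM2r; first by rewrite subr_ge0.
apply: ub_le_sup => //; exists c => //; exact: NI.
Qed.

(** * Growth of the window and of the rate *)

Lemma ln_le_root4 (R : realType) (x : R) : 0 < x ->
  ln x <= 4 * Num.sqrt (Num.sqrt x).
Proof.
move=> x0; set u := Num.sqrt (Num.sqrt x).
have u0 : 0 < u by rewrite !sqrtr_gt0.
have -> : x = u ^+ 4.
  by rewrite (exprM u 2 2) !sqr_sqrtr// ?sqrtr_ge0// ltW.
by rewrite lnXn// -[_ *+ 4]mulr_natl ler_wpM2l// ltW// ln_sublinear.
Qed.

(** The grid of [a] cells of length [a ^- 4] must cover the window. The denominator of the window is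
    at least [a ^ 4], and the numerator grows more slowly than [a], being a power of a logarithm. *)
Lemma window_le (R : realType) (K : R) : 0 < K -> \forall a \near \oo,
  forall n, (a ^ 8 <= n <= a.+1 ^ 8)%N ->
  Num.sqrt K * powR (ln n%:R) (3 / 2) / (Num.sqrt n%:R * Num.sqrt (ln (ln n%:R)))
    <= a%:R * (a%:R ^+ 4)^-1.
Proof.
move=> K0; near=> a => n /andP[an na].
have a1 : (1 : R) <= a%:R by near: a; exact: nbhs_infty_ger.
have a0 : 0 < (a%:R : R) by lra.
(* This threshold makes the iterated logarithm of [n] at least 1, as [a <= n]. *)
have aE : expR (expR 1) <= (a%:R : R) by near: a; exact: nbhs_infty_ger.
(* The square of the inequality [Ka] below, after [a + 1 <= 2 * a]; 32 is 8 from the exponent times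
   4 from [ln_le_root4]. *)
have aK : 2 * (32 ^+ 4 * K) <= (a%:R : R) by near: a; exact: nbhs_infty_ger.
have an' : (a%:R : R) ^+ 8 <= n%:R by rewrite -natrX ler_nat.
have na' : n%:R <= (a%:R + 1 : R) ^+ 8 by rewrite natr1 -natrX ler_nat.
have aa8 : (a%:R : R) <= a%:R ^+ 8 by rewrite ler_eXnr.
have n0 : 0 < (n%:R : R) by lra.
set l := ln (n%:R : R).
have le1 : expR 1 <= l.
  rewrite -[leLHS]expRK ler_ln ?posrE ?expR_gt0//; lra.
have e1 : 1 <= expR 1 :> R by apply: le_trans (expR_ge1Dx 1); rewrite lerDl.
have l1 : 1 <= l by lra.
have ll1 : 1 <= ln l.
  by rewrite -[leLHS]expRK ler_ln ?posrE ?expR_gt0//; lra.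
have sll : 1 <= Num.sqrt (ln l) by rewrite -[leLHS]sqrtr1 ler_wsqrtr.
have sn : (a%:R : R) ^+ 4 <= Num.sqrt n%:R.
  rewrite -[leLHS]ger0_norm ?exprn_ge0//.
  by rewrite -sqrtr_sqr ler_wsqrtr// -exprM.
have l2 : powR l (3 / 2) <= l ^+ 2.
  by rewrite -powR_mulrn; [apply: ler_powR => //; lra | lra].
have lu : l <= 32 * Num.sqrt (Num.sqrt (a%:R + 1)).
  apply: (@le_trans _ _ (ln ((a%:R + 1 : R) ^+ 8))).
    by rewrite ler_ln ?posrE// exprn_gt0//; lra.
  rewrite lnXn; last lra.
  have : ln (a%:R + 1 : R) <= 4 * Num.sqrt (Num.sqrt (a%:R + 1)).
    by apply: ln_le_root4; lra.
  by rewrite -[_ *+ 8]mulr_natl; lra.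
have l2u : l ^+ 2 <= 32 ^+ 2 * Num.sqrt (a%:R + 1).
  rewrite -[X in _ * X]sqr_sqrtr ?sqrtr_ge0// -exprMn.
  by rewrite ler_pXn2r// nnegrE; lra.
have Ka : Num.sqrt K * (32 ^+ 2 * Num.sqrt (a%:R + 1)) <= a%:R.
  set c : R := 32 ^+ 2.
  have c0 : 0 <= c by rewrite exprn_ge0.
  have cK : 2 * (c ^+ 2 * K) <= a%:R by rewrite /c -exprM.
  rewrite -[leRHS]ger0_norm// -sqrtr_sqr.
  rewrite -(ger0_norm c0) -sqrtr_sqr mulrCA -!sqrtrM ?sqr_ge0 ?(ltW K0)//.
  apply: ler_wsqrtr; rewrite mulrA.
  set z := c ^+ 2 * K in cK *.
  have : z * (a%:R + 1) <= z * (2 * a%:R).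
    by apply: ler_wpM2l; [rewrite mulr_ge0 ?sqr_ge0// ltW|lra].
  have : (2 * z) * a%:R <= a%:R * a%:R by apply: ler_wpM2r.
  by rewrite expr2 -[2 * z * _]mulrA [2 * (_ * _)]mulrCA => /[swap] /le_trans /[apply].
apply: ler_pM => //.
- by rewrite mulr_ge0 ?sqrtr_ge0 ?powR_ge0.
- apply: le_trans Ka; apply: ler_wpM2l; first exact: sqrtr_ge0.
  exact: le_trans l2 l2u.
- rewrite lef_pV2 ?posrE ?exprn_gt0//.
  + apply: (le_trans sn); rewrite ler_peMr ?sqrtr_ge0//.
  + by rewrite mulr_gt0 ?sqrtr_gt0//; lra.
Unshelve. all: end_near. Qed.

(** Since [a ^ 8 <= n], the left side is at most C / sqrt n, and [C ^ 2 <= K * ln n] once [a]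
    exceeds exp(C^2 / K). The logarithm thus absorbs every constant. *)
Lemma log_rate_ge (R : realType) (K C : R) : 0 < K -> 0 <= C ->
  \forall a \near \oo, forall n, (a ^ 8 <= n)%N ->
  n%:R^-1 * (C * a%:R ^+ 4) <= Num.sqrt (K * ln n%:R / n%:R).
Proof.
move=> K0 C0; near=> a => n an.
have a1 : (1 : R) <= a%:R by near: a; exact: nbhs_infty_ger.
have a0 : 0 < (a%:R : R) by lra.
have aE : expR (C ^+ 2 / K) <= (a%:R : R) by near: a; exact: nbhs_infty_ger.
have an' : (a%:R : R) ^+ 8 <= n%:R by rewrite -natrX ler_nat.
have aa8 : (a%:R : R) <= a%:R ^+ 8 by rewrite ler_eXnr.
have n0 : 0 < (n%:R : R) by lra.
have Cl : C ^+ 2 <= K * ln n%:R.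
  rewrite mulrC -ler_pdivrMr//.
  by rewrite -[leLHS]expRK ler_ln ?posrE ?expR_gt0//; lra.
have h0 : 0 <= n%:R^-1 * (C * a%:R ^+ 4) :> R.
  by rewrite !mulr_ge0 ?invr_ge0 ?exprn_ge0//; lra.
rewrite -[leLHS]ger0_norm// -sqrtr_sqr; apply: ler_wsqrtr.
have -> : (n%:R^-1 * (C * a%:R ^+ 4)) ^+ 2 = C ^+ 2 * (a%:R ^+ 8 / n%:R) / n%:R :> R.
  by field; lra.
apply: ler_wpM2r; first by rewrite invr_ge0 ltW.
apply: le_trans Cl; rewrite ler_piMr ?sqr_ge0//.
by rewrite ler_pdivrMr// mul1r.
Unshelve. all: end_near. Qed.

(** * Summability and the Borel-Cantelli lemma *)

Lemma sum_inv_sqr_le (R : realType) n : \sum_(0 <= j < n) (j.+1%:R ^+ 2)^-1 <= 2 :> R.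
Proof.
(* The sharper bound passes through the induction, because 1/(n+1)^2 <= 2/(n+1) - 2/(n+2). *)
suff : \sum_(0 <= j < n) (j.+1%:R ^+ 2)^-1 <= 2 - 2 / n.+1%:R :> R.
  by move/le_trans; apply; rewrite gerBl divr_ge0.
elim: n => [|n IH]; first by rewrite big_nil divr1 subrr.
rewrite big_nat_recr//=; apply: (le_trans (lerD IH (lexx _))).
rewrite -subr_ge0.
have -> : 2 - 2 / n.+2%:R - (2 - 2 / n.+1%:R + (n.+1%:R ^+ 2)^-1) =
    n%:R / (n.+1%:R ^+ 2 * n.+2%:R) :> R.
  have := ltr0Sn R n; have := ltr0Sn R n.+1; rewrite -!natr1 => h1 h2.
  by field; lra.
by rewrite divr_ge0// mulr_ge0.
Qed.

Lemma borel_cantelli_inv_sqr (d : measure_display) (T : measurableType d)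
    (R : realType) (P : probability T R) (E : nat -> set T) (C : R) :
  0 <= C -> (forall j, measurable (E j)) ->
  (forall j, P (E j) <= (C * (j.+1%:R ^+ 2)^-1)%:E)%E ->
  {ae P, forall w, \forall j \near \oo, ~ E j w}.
Proof.
move=> C0 mE PE; exists (lim_sup_set E); split.
- apply: bigcapT_measurable => n; apply: bigcup_measurable => j _; exact: mE.
- apply: lim_sup_set_cvg0 => //; apply: (@le_lt_trans _ _ (C * 2)%:E); last exact: ltry.
  apply: lime_le; first by apply: is_cvg_nneseries => j _ _.
  apply: nearW => n; apply: (@le_trans _ _ (\sum_(0 <= j < n) (C * (j.+1%:R ^+ 2)^-1)%:E)%E).
    by apply: lee_sum => j _; exact: PE.
  by rewrite sumEFin lee_fin -mulr_sumr ler_wpM2l// sum_inv_sqr_le.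
- move=> w /= h n _; apply: contrapT => hn; apply: h.
  exists n => // j /= nj Ej; apply: hn; by exists j.
Qed.

(** * Blocks between consecutive eighth powers and their exceptional events *)

(** Binomial expansion: the coefficients below the leading one sum to 2^8 - 1 = 255, and for
    [1 <= a] every lower power is at most [a ^ 7]. *)
Lemma succ_exp8_le (R : realType) (a : R) : 1 <= a ->
  (a + 1) ^+ 8 <= a ^+ 8 + 255 * a ^+ 7.
Proof.
move=> a1.
have E i : (i <= 7)%N -> a ^+ i <= a ^+ 7 by move=> i7; rewrite ler_weXn2l.
have := E 0%N isT; have := E 1%N isT; have := E 2%N isT; have := E 3%N isT.
have := E 4%N isT; have := E 5%N isT; have := E 6%N isT.
have -> : (a + 1) ^+ 8 = a ^+ 8 + 8 * a ^+ 7 + 28 * a ^+ 6 + 56 * a ^+ 5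
  + 70 * a ^+ 4 + 56 * a ^+ 3 + 28 * a ^+ 2 + 8 * a ^+ 1 + a ^+ 0 by ring.
set x7 := a ^+ 7; set x6 := a ^+ 6; set x5 := a ^+ 5; set x4 := a ^+ 4.
set x3 := a ^+ 3; set x2 := a ^+ 2; set x1 := a ^+ 1; set x0 := a ^+ 0.
set x8 := a ^+ 8; lra.
Qed.

Section GridEvents.
Context {d : measure_display} {T : measurableType d} {R : realType}.
Variables (P : probability T R) (X : nat -> T -> R) (F : R -> R).
Variables (xi e D : R).
Hypothesis mX : forall i, measurable_fun setT (X i).
Hypothesis XF : forall i, (1 <= i)%N -> forall x, P [set w | X i w <= x] = (F x)%:E.
Hypothesis cvg_sqrt_phi : cvgn (series (fun k => Num.sqrt (phi_mix P X k.+1))).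
Hypothesis D0 : 0 <= D.
Hypothesis F_lipschitz : forall x y, xi - e < x -> x <= y -> y < xi + e ->
  F y - F x <= D * (y - x).
Let S := limn (series (fun k => Num.sqrt (phi_mix P X k.+1))).

(** At time [a ^ 8], a cell of this length has expected count of order [a ^ 4], the square root of
    the time and the error allowed. *)
Definition step (a : nat) : R := (a%:R ^+ 4)^-1.

Definition side_dev (a m k : nat) : set T :=
  cnt_dev X F (a%:R ^+ 4) m xi (xi + k%:R * step a) `|`
  cnt_dev X F (a%:R ^+ 4) m (xi - k%:R * step a) xi.

(** Both end times of the block enter, with the same level [a ^ 4], so that off this event the whole
    block can be interpolated. *)
Definition grid_dev (a : nat) : set T :=
  \big[setU/set0]_(k < a.+1) (side_dev a (a ^ 8) k `|` side_dev a (a.+1 ^ 8) k).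

Lemma probabilityU_le (A B : set T) : measurable A -> measurable B ->
  (P (A `|` B) <= P A + P B)%E.
Proof. by move=> mA mB; exact: measureU2. Qed.

Lemma measurable_side_dev a m k : measurable (side_dev a m k).
Proof. by apply: measurableU; exact: measurable_cnt_dev. Qed.

Lemma measurable_grid_dev a : measurable (grid_dev a).
Proof.
by apply: bigsetU_measurable => k _; apply: measurableU; exact: measurable_side_dev.
Qed.

Lemma step_gt0 a : (0 < a)%N -> 0 < step a.
Proof. by move=> a0; rewrite invr_gt0 exprn_gt0// ltr0n. Qed.

Lemma succ_exp8_le256 (a : nat) : (0 < a)%N -> (a.+1 ^ 8)%:R <= 256 * a%:R ^+ 8 :> R.
Proof.
move=> a0; rewrite natrX -natr1.
have a1 : (1 : R) <= a%:R by rewrite ler1n.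
apply: (le_trans (succ_exp8_le _ _ a1)).
have : (a%:R : R) ^+ 7 <= a%:R ^+ 8 by rewrite ler_weXn2l.
set x := _ ^+ 7; set y := _ ^+ 8; lra.
Qed.

(** 256 bounds the ratio of the end times of a block, [D] is the Lipschitz constant of [F], and the
    last factor comes from the covariances. *)
Let dev_const := 256 * D * (1 + 2 * S).

Lemma dev_const_ge0 : 0 <= dev_const.
Proof.
have := sum_sqrt_phi_mix_ge0 P X cvg_sqrt_phi; rewrite -/S => S0.
by rewrite !mulr_ge0//; lra.
Qed.

Lemma probability_cnt_dev_grid a m x y : (0 < a)%N -> (m <= a.+1 ^ 8)%N ->
  x <= y -> F y - F x <= D * (a%:R * step a) ->
  (P (cnt_dev X F (a%:R ^+ 4) m x y) <= (dev_const * (a%:R * step a))%:E)%E.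
Proof.
move=> a0 ma xy Fxy.
have a0' : 0 < (a%:R : R) by rewrite ltr0n.
have t0 : 0 < (a%:R : R) ^+ 4 by rewrite exprn_gt0.
apply: le_trans (probability_cnt_dev P X F mX XF cvg_sqrt_phi _ m x y xy t0) _.
rewrite lee_fin -/S.
have S0 : 0 <= 1 + 2 * S.
  by have := sum_sqrt_phi_mix_ge0 P X cvg_sqrt_phi; rewrite -/S; lra.
have Fxy0 : 0 <= F y - F x by rewrite subr_ge0 (cdf_homo P X F mX XF).
rewrite -exprM ler_pdivrMr ?exprn_gt0//.
have -> : dev_const * (a%:R * step a) * a%:R ^+ (4 * 2) =
    (256 * a%:R ^+ 8) * (D * (a%:R * step a)) * (1 + 2 * S).
  by rewrite /dev_const; set u := a%:R * step a; ring.
apply: ler_wpM2r => //; apply: ler_pM => //.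
apply: le_trans (succ_exp8_le256 _ a0); by rewrite ler_nat.
Qed.

(** Union bound: four events per grid point (two sides, two times), [a.+1 <= 2 * a] grid points, and
    a cost of [dev_const * a ^- 3] for each event. The bound on the radius keeps the grid where [F]
    is Lipschitz. *)
Lemma probability_grid_dev a : (0 < a)%N -> a%:R * step a < e ->
  (P (grid_dev a) <= (8 * dev_const * (a%:R ^+ 2)^-1)%:E)%E.
Proof.
move=> a0 ae.
have s0 := step_gt0 a a0; have V0 := dev_const_ge0.
have side m k : (m <= a.+1 ^ 8)%N -> (k <= a)%N ->
    (P (side_dev a m k) <= (2 * (dev_const * (a%:R * step a)))%:E)%E.
  move=> ma ka; have ks0 : 0 <= k%:R * step a by rewrite mulr_ge0// ltW.
  have ksa : k%:R * step a <= a%:R * step a by rewrite ler_wpM2r ?ler_nat// ltW.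
  have Dks : D * (k%:R * step a) <= D * (a%:R * step a) by rewrite ler_wpM2l.
  apply: (le_trans (probabilityU_le _ _ _ _)); [exact: measurable_cnt_dev..|].
  rewrite mulrDl mul1r EFinD; apply: leeD; apply: probability_cnt_dev_grid => //.
  - by rewrite lerDl.
  - apply: (@le_trans _ _ (D * (xi + k%:R * step a - xi))); last by rewrite addrAC subrr add0r.
    by apply: F_lipschitz; lra.
  - by rewrite gerBl.
  - apply: (@le_trans _ _ (D * (xi - (xi - k%:R * step a)))); last by rewrite subKr.
    by apply: F_lipschitz; lra.
apply: (@le_trans _ _ (\sum_(k < a.+1) (4 * (dev_const * (a%:R * step a)))%:E)%E).
  apply: (le_trans (@Boole_inequality _ _ _ P
    (fun k => side_dev a (a ^ 8) k `|` side_dev a (a.+1 ^ 8) k) _ _)).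
    by move=> k _; apply: measurableU; exact: measurable_side_dev.
  apply: lee_sum => k _.
  apply: (le_trans (probabilityU_le _ _ _ _)); [exact: measurable_side_dev..|].
  have -> : 4 * (dev_const * (a%:R * step a)) =
    2 * (dev_const * (a%:R * step a)) + 2 * (dev_const * (a%:R * step a)) by ring.
  have ka : (k <= a)%N by rewrite -ltnS.
  by rewrite EFinD; apply: leeD; apply: side => //; rewrite leq_exp2r.
rewrite sumEFin lee_fin sumr_const card_ord -[_ *+ a.+1]mulr_natl -natr1.
have a0' : 0 < (a%:R : R) by rewrite ltr0n.
have a1 : (1 : R) <= a%:R by rewrite ler1n.
have -> : (8 * dev_const * (a%:R ^+ 2)^-1) = (2 * a%:R) * (4 * (dev_const * (a%:R * step a))).
  by rewrite /step; field; lra.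
apply: ler_wpM2r; last by lra.
apply: mulr_ge0 => //; apply: mulr_ge0 => //; apply: mulr_ge0 => //.
exact: ltW.
Qed.

Lemma grid_devN a m k w : (k <= a)%N -> m = (a ^ 8)%N \/ m = (a.+1 ^ 8)%N ->
  ~ grid_dev a w -> ~ side_dev a m k w.
Proof.
move=> ka hm h sd; apply: h; rewrite /grid_dev.
rewrite -(bigcup_mkord _ (fun k => side_dev a (a ^ 8) k `|` side_dev a (a.+1 ^ 8) k)).
by exists k; [rewrite /= ltnS|case: hm => <-; [left|right]].
Qed.

(** The constant adds 1 for the deviation at grid points, 255 [D] for the time gap [255 * a ^ 7]
    times the mass [D * a ^- 3], and 256 [D] for [n <= 256 * a ^ 8] times the mass [D * a ^- 4] of a
    cell. *)
Lemma off_grid_dev a n w u : (0 < a)%N -> a%:R * step a < e ->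
  (a ^ 8 <= n <= a.+1 ^ 8)%N -> ~ grid_dev a w ->
  0 <= u <= a%:R * step a ->
  `|cnt X n xi (xi + u) w - n%:R * (F (xi + u) - F xi)| <= (1 + 511 * D) * a%:R ^+ 4
  /\
  `|cnt X n (xi - u) xi w - n%:R * (F xi - F (xi - u))| <= (1 + 511 * D) * a%:R ^+ 4.
Proof.
move=> a0 ae an good ua.
have a1 : (1 : R) <= a%:R by rewrite ler1n.
have s0 := step_gt0 a a0.
have Fh := cdf_homo P X F mX XF.
have bound : a%:R ^+ 4 + ((a.+1 ^ 8)%:R - (a ^ 8)%:R) * (D * (a%:R * step a)) +
    n%:R * (D * step a) <= (1 + 511 * D) * a%:R ^+ 4.
  have E1 : ((a.+1 ^ 8)%:R - (a ^ 8)%:R) * (D * (a%:R * step a)) <= 255 * D * a%:R ^+ 4.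
    have -> : 255 * D * a%:R ^+ 4 = (255 * a%:R ^+ 7) * (D * (a%:R * step a)).
      by rewrite /step; field; lra.
    apply: ler_wpM2r; first by rewrite !mulr_ge0// ltW.
    rewrite !natrX -natr1 lerBlDl; exact: succ_exp8_le.
  have E2 : n%:R * (D * step a) <= 256 * D * a%:R ^+ 4.
    have -> : 256 * D * a%:R ^+ 4 = (256 * a%:R ^+ 8) * (D * step a).
      by rewrite /step; field; lra.
    apply: ler_wpM2r; first by rewrite mulr_ge0// ltW.
    apply: le_trans (succ_exp8_le256 _ a0); rewrite ler_nat.
    by case/andP: an.
  move: E1 E2; set x := _ * (D * (_ * _)); set y := _ * (D * _).
  set z := a%:R ^+ 4; lra.
(* [grid_deviation] writes the number of cells as a successor. *)
have aE : a = a.-1.+1 by rewrite prednK.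
rewrite [X in D * (X%:R * _)]aE in bound.
have uu : 0 <= u <= a.-1.+1%:R * step a by rewrite -aE.
split.
- apply: le_trans bound.
  apply: (@grid_deviation _ (fun m v => cnt X m xi (xi + v) w)
    (fun v => F (xi + v) - F xi) D (step a) (a%:R ^+ 4) (a ^ 8) n (a.+1 ^ 8)) => //.
  + by move=> m m' v v' mm' v0 vv'; apply: cnt_homo => //; rewrite lerD2l.
  + by rewrite addr0 subrr.
  + move=> v v' v0 vv'; rewrite -aE => v'a.
    have -> : F (xi + v') - F xi - (F (xi + v) - F xi) = F (xi + v') - F (xi + v) by ring.
    rewrite subr_ge0 Fh ?lerD2l//=.
    have -> : v' - v = xi + v' - (xi + v) by ring.
    by apply: F_lipschitz; lra.
  + rewrite -aE => k ka; rewrite leNgt; apply/negP => h.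
    by apply: (grid_devN a (a ^ 8) k w ka) good _; [left|left; exact: ltW].
  + rewrite -aE => k ka; rewrite leNgt; apply/negP => h.
    by apply: (grid_devN a (a.+1 ^ 8) k w ka) good _; [right|left; exact: ltW].
  + exact: ltW.
(* On the left the distance to [xi] is the parameter, so the count again increases with it. *)
- apply: le_trans bound.
  apply: (@grid_deviation _ (fun m v => cnt X m (xi - v) xi w)
    (fun v => F xi - F (xi - v)) D (step a) (a%:R ^+ 4) (a ^ 8) n (a.+1 ^ 8)) => //.
  + by move=> m m' v v' mm' v0 vv'; apply: cnt_homo => //; rewrite lerD2l lerN2.
  + by rewrite subr0 subrr.
  + move=> v v' v0 vv'; rewrite -aE => v'a.
    have -> : F xi - F (xi - v') - (F xi - F (xi - v)) = F (xi - v) - F (xi - v') by ring.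
    rewrite subr_ge0 Fh ?lerD2l ?lerN2//=.
    have -> : v' - v = xi - v - (xi - v') by ring.
    by apply: F_lipschitz; lra.
  + rewrite -aE => k ka; rewrite leNgt; apply/negP => h.
    by apply: (grid_devN a (a ^ 8) k w ka) good _; [left|right; exact: ltW].
  + rewrite -aE => k ka; rewrite leNgt; apply/negP => h.
    by apply: (grid_devN a (a.+1 ^ 8) k w ka) good _; [right|right; exact: ltW].
  + exact: ltW.
Qed.

Lemma near_radius_lt : 0 < e -> \forall a \near \oo, a%:R * step a < e.
Proof.
move=> e0; near=> a.
have a1 : (1 : R) <= a%:R by near: a; exact: nbhs_infty_ger.
have ae : e^-1 + 1 <= (a%:R : R) by near: a; exact: nbhs_infty_ger.
have -> : a%:R * step a = (a%:R ^+ 3)^-1 by rewrite /step; field; lra.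
rewrite -[ltRHS]invrK ltf_pV2 ?posrE ?exprn_gt0 ?invr_gt0//; try lra.
have : (a%:R : R) <= a%:R ^+ 3 by rewrite ler_eXnr.
set x := _ ^+ 3; lra.
Unshelve. all: end_near. Qed.

Lemma ae_not_grid_dev : 0 < e ->
  {ae P, forall w, \forall a \near \oo, ~ grid_dev a w}.
Proof.
move=> e0.
have [j0 _ Hj0] : \forall a \near \oo, (0 < a)%N /\ a%:R * step a < e.
  near=> a; split; first by near: a; exact: nbhs_infty_gt.
  by near: a; exact: near_radius_lt.
have Hj j : (0 < j + j0.+1)%N /\ (j + j0.+1)%:R * step (j + j0.+1) < e.
  by apply: Hj0 => /=; rewrite addnS leqW// leq_addl.
have V0 := dev_const_ge0.
(* The shift by [j0.+1] leaves only indices where the probability bound holds, and it makes the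
   index at least [j.+1]. *)
have := borel_cantelli_inv_sqr _ _ _ P (fun j => grid_dev (j + j0.+1)) (8 * dev_const).
move=> /(_ _ _ _)[]; first by rewrite mulr_ge0.
- by move=> j; exact: measurable_grid_dev.
- move=> j; have [h1 h2] := Hj j; apply: (le_trans (probability_grid_dev _ h1 h2)).
  rewrite lee_fin; apply: ler_wpM2l; first by rewrite mulr_ge0.
  rewrite lef_pV2 ?posrE ?exprn_gt0 ?ltr0n//.
  by rewrite ler_pXn2r ?nnegrE// ler_nat addnS ltnS leq_addr.
move=> A [mA A0 sA]; exists A; split => // w /= h; apply: sA => /= -[j1 _ Hj1].
apply: h; exists (j1 + j0.+1)%N => // a /= ja.
have j0a : (j0.+1 <= a)%N by apply: leq_trans ja; exact: leq_addl.
have /Hj1 : (j1 <= a - j0.+1)%N by rewrite leq_subRL// addnC.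
by rewrite subnK.
Unshelve. all: end_near. Qed.

End GridEvents.

(** * Assembly of the almost sure bound *)

Lemma exp8_floor n : exists a : nat, (a ^ 8 <= n < a.+1 ^ 8)%N.
Proof.
have ex : exists a, (a ^ 8 <= n)%N by exists 0%N; rewrite exp0n.
have ub a : (a ^ 8 <= n)%N -> (a <= n)%N.
  by case: a => // a; apply: leq_trans; rewrite expnS leq_pmulr// expn_gt0.
have [a an amax] := ex_maxnP ex ub; exists a; rewrite an/= ltnNge.
by apply/negP => /amax; rewrite ltnn.
Qed.

Theorem theorem2p3 (d : measure_display) (T : measurableType d) (R : realType)
  (P : probability T R) (X : nat -> T -> R) (F : R -> R)
  (p : R) (N : set R) (f : R -> R) (theta : R) :
  (forall i, measurable_fun setT (X i)) ->
  (* common marginal distribution function F *)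
  (forall i, (1 <= i)%N -> forall x, P [set w | X i w <= x] = (F x)%:E) ->
  (* phi-mixing: phi(n) decreases to 0 *)
  {homo phi_mix P X : m n / (m <= n)%N >-> n <= m} ->
  phi_mix P X n @[n --> \oo] --> 0 ->
  (* sum_{n>=1} phi^{1/2}(n) < oo *)
  cvgn (series (fun k => Num.sqrt (phi_mix P X k.+1))) ->
  0 < p < 1 ->
  let xi := inf [set x | p <= F x] in
  (* positive continuous density f on a neighborhood N of xi_p *)
  open N -> N xi ->
  {within N, continuous f} ->
  (forall x, N x -> 0 < f x) ->
  (forall x, N x -> is_derive x 1 F (f x)) ->
  has_ubound (f @` N) ->
  let dd := sup (f @` N) in
  0 < dd ->
  0 < theta ->
  let C3 := 4 * (1 + 4 * limn (series (fun k => Num.sqrt (phi_mix P X k.+1)))) in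
  let tau := fun n : nat =>
    Num.sqrt (16 * C3 + theta) * powR (ln n%:R) (3 / 2) /
    (Num.sqrt n%:R * Num.sqrt (ln (ln n%:R))) in
  {ae P, forall w, \forall n \near \oo,
     sup [set `| (empF X n w x - F x) - (empF X n w xi - p) |
          | x in `[xi - tau n, xi + tau n]]
     <= (1 + dd) * Num.sqrt ((16 * C3 + theta) * ln n%:R / n%:R)}.
Proof.
move=> mX XF _ _ cvg_phi p01 xi oN Nxi _ _ dF ubf dd dd0 theta0 C3 tau.
have S0 := sum_sqrt_phi_mix_ge0 P X cvg_phi.
set K := 16 * C3 + theta.
have K0 : 0 < K by rewrite /K /C3; lra.
have Fxi : F xi = p.
  apply: (@cdf_quantile _ _ _ P (X 1%N)) => //; first exact: XF.
  have [dFxi _] := dF xi Nxi.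
  exact/differentiable_continuous/derivable1_diffP.
have [e e0 FL] := density_lipschitz R F f N xi oN Nxi dF ubf.
have [A [mA A0 sA]] := ae_not_grid_dev P X F xi e dd mX XF cvg_phi (ltW dd0) FL e0.
exists A; split => // w /= h; apply: sA => /= good; apply: h.
have C0 : 0 <= 1 + 511 * dd by lra.
(* One threshold, depending on [w], collects all eventual facts; every [n] beyond [a0 ^ 8] lies in a
   block with index at least [a0]. *)
have [a0 _ Ha0] : \forall a \near \oo, [/\ ~ grid_dev X F xi a w,
    (0 < a)%N, a%:R * step a < e,
    forall n, (a ^ 8 <= n <= a.+1 ^ 8)%N -> tau n <= a%:R * step a &
    forall n, (a ^ 8 <= n)%N -> n%:R^-1 * ((1 + 511 * dd) * a%:R ^+ 4) <=
      Num.sqrt (K * ln n%:R / n%:R)].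
  near=> a; split.
  - by near: a.
  - by near: a; exact: nbhs_infty_gt.
  - by near: a; exact: near_radius_lt.
  - by near: a; exact: window_le.
  - by near: a; exact: log_rate_ge.
exists (a0 ^ 8)%N => // n /= a0n.
have [a /andP[an na]] := exp8_floor n.
have /Ha0[gooda a_gt0 ae taua rate] : (a0 <= a)%N.
  by rewrite -ltnS -(ltn_exp2r _ _ (isT : 0 < 8)%N); exact: leq_ltn_trans na.
have aan : (a ^ 8 <= n <= a.+1 ^ 8)%N by rewrite an ltnW.
have n_gt0 : 0 < (n%:R : R).
  by rewrite ltr0n; apply: leq_trans an; rewrite expn_gt0 a_gt0.
have tau0 : 0 <= tau n.
  by rewrite divr_ge0 ?mulr_ge0 ?sqrtr_ge0 ?powR_ge0.
(* Bounding a supremum by its upper bounds requires a nonempty set; [xi] itself lies in the window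
   since [tau n] is nonnegative. *)
apply: ge_sup.
  by exists `|(empF X n w xi - F xi) - (empF X n w xi - p)|; exists xi => //=;
    rewrite in_itv/=; lra.
move=> _ [x /= /[!in_itv]/= /andP[x1 x2] <-].
(* The factor [1 + dd] is at least 1, so the bound without it is enough. *)
apply: (@le_trans _ _ (Num.sqrt (K * ln n%:R / n%:R))); last first.
  by rewrite ler_peMl ?sqrtr_ge0//; lra.
apply: le_trans (rate n an); have := taua n aan => taun.
have n0 : n%:R^-1 * n%:R = 1 :> R by rewrite mulVf// gt_eqF.
have [xix|xxi] := leP xi x.
- have [|+ _] := off_grid_dev P X F xi e dd mX XF (ltW dd0) FL a n w (x - xi)
      a_gt0 ae aan gooda; first lra.
  rewrite subrKC => H.
  have -> : empF X n w x - F x - (empF X n w xi - p) =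
      n%:R^-1 * (cnt X n xi x w - n%:R * (F x - F xi)).
    rewrite mulrBr -empFB// mulrA n0 Fxi; ring.
  by rewrite normrM ger0_norm ?invr_ge0 ?(ltW n_gt0)// ler_wpM2l ?invr_ge0 ?(ltW n_gt0).
(* To the left of [xi] both increments change sign, which the absolute value removes. *)
- have [|_] := off_grid_dev P X F xi e dd mX XF (ltW dd0) FL a n w (xi - x)
      a_gt0 ae aan gooda; first lra.
  rewrite subKr => H.
  have -> : empF X n w x - F x - (empF X n w xi - p) =
      - (n%:R^-1 * (cnt X n x xi w - n%:R * (F xi - F x))).
    rewrite mulrBr -empFB ?ltW// mulrA n0 Fxi; ring.
  by rewrite normrN normrM ger0_norm ?invr_ge0 ?(ltW n_gt0)// ler_wpM2l ?invr_ge0 ?(ltW n_gt0).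
Unshelve. all: end_near. Qed.
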